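(* Let $(T_n)_{n\in\mathbb N}$ be the Rémy chain, let $n\in\mathbb N$ and let $\mathbf t$ be a binary tree with $2n+3$ vertices. The conditional distribution of $T_n$ given $T_{n+1}=\mathbf t$ is the distribution of the random binary tree obtained from $\mathbf t$ by the following procedure: pick a leaf of $\mathbf t$ uniformly at random; delete the chosen leaf and its sibling (the sibling may or may not be a leaf); if the sibling is not a leaf, close up the resulting gap by attaching the subtrees below the sibling to the parent of the chosen leaf and the sibling (so that the subtree rooted at the parent is replaced by the subtree that was rooted at the sibling).
   Context: $\mathbb N=\{1,2,\dots\}$. A binary tree is a finite rooted planar tree in which every vertex has zero or two children, left and right children being distinguished; it has $n+1$ leaves and $2n+1$ vertices for some $n$. $\aleph$ is the unique binary tree with 3 vertices. Rémy chain $(T_n)_{n\in\mathbb N}$: the Markov chain with $T_1=\aleph$ in which $T_{n+1}$ is obtained from $T_n$ by picking a vertex $v$ of $T_n$ uniformly at random, cutting off the subtree rooted at $v$, attaching a copy of $\aleph$ at the place where $v$ was, and re-attaching the cut-off subtree to one of the two leaves of the copy of $\aleph$, chosen uniformly at random. So $T_n$ has $2n+1$ vertices, and every binary tree with $2n+1$ vertices is attained with positive probability at time $n$. *)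

(* Defs.v *)
From HB Require Import structures.
From mathcomp Require Import all_boot all_order all_algebra.
From mathcomp Require Import all_classical all_reals all_analysis.
Set Implicit Arguments.
Unset Strict Implicit.
Unset Printing Implicit Defensive.
Import Order.TTheory GRing.Theory Num.Theory.
Local Open Scope classical_set_scope.
Local Open Scope ring_scope.

Inductive bintree : Type := Leaf | Node of bintree & bintree.

Fixpoint bintree_encode (t : bintree) : GenTree.tree nat :=
  if t is Node l r
  then GenTree.Node 0 [:: bintree_encode l; bintree_encode r]
  else GenTree.Leaf 0%N.

Fixpoint bintree_decode (g : GenTree.tree nat) : bintree :=
  if g is GenTree.Node _ [:: l; r]
  then Node (bintree_decode l) (bintree_decode r) else Leaf.

Lemma bintree_encodeK : cancel bintree_encode bintree_decode.
Proof. by elim=> //= l -> r ->. Qed.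

HB.instance Definition _ := Countable.copy bintree (can_type bintree_encodeK).
HB.instance Definition _ := isPointed.Build bintree Leaf.
HB.instance Definition _ := @isMeasurable.Build default_measure_display
  bintree discrete_measurable discrete_measurable0
  discrete_measurableC discrete_measurableU.

Definition aleph : bintree := Node Leaf Leaf.

(* A vertex is the path leading to it from the root: [false] goes to the left
   child, [true] to the right child, and [[::]] is the root. *)
Fixpoint vertices (t : bintree) : seq (seq bool) :=
  [::] :: if t is Node l r
          then map (cons false) (vertices l) ++ map (cons true) (vertices r)
          else [::].

(* Junk value [Leaf] when [v] is not a vertex of [t]. *)
Fixpoint subtree (t : bintree) (v : seq bool) : bintree :=
  match v, t with
  | [::], _ => t
  | b :: v', Node l r => subtree (if b then r else l) v'
  | _ :: _, Leaf => Leaf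
  end.

(* The subtree of [t] rooted at [v] is replaced by [s]; nothing changes when
   [v] is not a vertex of [t]. *)
Fixpoint replace (t : bintree) (v : seq bool) (s : bintree) : bintree :=
  match v, t with
  | [::], _ => s
  | b :: v', Node l r =>
      if b then Node l (replace r v' s) else Node (replace l v' s) r
  | _ :: _, Leaf => Leaf
  end.

Definition leaves (t : bintree) : seq (seq bool) :=
  [seq v <- vertices t | subtree t v == Leaf].

Definition parent (v : seq bool) : seq bool := take (size v).-1 v.

(* Meaningful for [v != [::]] only: the root has no sibling. *)
Definition sibling (v : seq bool) : seq bool :=
  rcons (parent v) (~~ last false v).

(* A choice [(v, b)] consists of the vertex at which the copy of [aleph] is
   inserted and of the leaf ([false]: left, [true]: right) of that copy to
   which the cut-off subtree is re-attached. *)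
Definition remy_choices (t : bintree) : seq (seq bool * bool) :=
  [seq (v, b) | v <- vertices t, b <- [:: false; true]].

Definition remy_insert (t : bintree) (c : seq bool * bool) : bintree :=
  replace t c.1 (replace aleph [:: c.2] (subtree t c.1)).

(* If the sibling of the leaf [v] is itself a leaf, its subtree is [Leaf]:
   both are deleted and their parent becomes a leaf. Otherwise the gap is
   closed up by the subtree rooted at the sibling. *)
Definition remove_leaf (t : bintree) (v : seq bool) : bintree :=
  replace t (parent v) (subtree t (sibling v)).

Section laws.
Variable R : realType.

(* Law of [f i] for [i] uniform in the nonempty duplicate-free list [s]. *)
Definition uniform_law (I T : Type) (s : seq I) (f : I -> T) (A : set T) : R :=
  (\sum_(i <- s) \1_A (f i)) / (size s)%:R.

Definition remy_kernel (s : bintree) : set bintree -> R :=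
  uniform_law (remy_choices s) (remy_insert s).

Definition leaf_removal_law (t : bintree) : set bintree -> R :=
  uniform_law (leaves t) (remove_leaf t).

Context d (Omega : measurableType d) (P : probability Omega R).

(* As division by 0 gives 0, this is 0 whenever [P B = 0]. *)
Definition cond_prob (A B : set Omega) : R := fine (P (A `&` B)) / fine (P B).

(* Time runs over 1, 2, ...; [T 0] is unconstrained. The second field is the
   Markov property together with the one-step transition probabilities. *)
Record remy_chain (T : nat -> {RV P >-> bintree}) : Prop := RemyChain {
  remy_chain_start : P (T 1%N @^-1` [set aleph]) = 1%E;
  remy_chain_step : forall (n : nat) (x : nat -> bintree) (y : bintree),
    (0 < n)%N ->
    let history := \bigcap_(k in [set k | (0 < k <= n)%N]) T k @^-1` [set x k] in
    P history != 0%E ->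
    cond_prob (T n.+1 @^-1` [set y]) history = remy_kernel (x n) [set y]
}.

End laws.

(* Main.v *)
Require Import Defs.
From mathcomp Require Import all_boot all_order all_algebra.
From mathcomp Require Import all_classical all_reals all_analysis.
From mathcomp Require Import zify ring.
Import Order.TTheory GRing.Theory Num.Theory.
Local Open Scope classical_set_scope.
Local Open Scope ring_scope.

(** An insertion is determined by the resulting tree together with the leaf it
    creates. Hence exactly as many of the equiprobable choices turn [s] into [t]
    as there are leaves of [t] whose removal gives [s]. A tree with [2n+3]
    vertices has [n+2] leaves, so by induction [T n] is uniform on the trees
    with [2n+1] vertices, and Bayes' rule leaves only the count of leaves. The
    Markov hypothesis conditions on the whole history, so the one-step law given
    [T n] alone is recovered by summing out the past, one time at a time. *)

(** * Paths, subtrees and replacement *)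

Lemma subtree_nil t : subtree t [::] = t.
Proof. by case: t. Qed.

Lemma replace_nil t s : replace t [::] s = s.
Proof. by case: t. Qed.

Lemma subtree_cat t u v : subtree t (u ++ v) = subtree (subtree t u) v.
Proof.
elim: u t => [|b u IHu] [|l r] //=.
by case: (v).
Qed.

Lemma subtree_rcons t v b :
  subtree t (rcons v b) = subtree (subtree t v) [:: b].
Proof. by rewrite -cats1 subtree_cat. Qed.

Lemma replace_subtree t v : replace t v (subtree t v) = t.
Proof.
by elim: v t => [|[] v IHv] [|l r] //; rewrite ?replace_nil //= IHv.
Qed.

Lemma nil_vertices t : [::] \in vertices t.
Proof. by case: t => *; rewrite inE. Qed.

Lemma cons_vertices l r (b : bool) (v : seq bool) :
  (b :: v \in vertices (Node l r)) = (v \in vertices (if b then r else l)).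
Proof.
have cons_inj c : injective (cons c) by move=> u w [].
have notin s : (b :: v \in map (cons (~~ b)) s) = false.
  by apply/mapP => -[u _ []]; case: (b).
rewrite /= inE mem_cat; case: b notin => /= notin.
  by rewrite notin //= mem_map //; apply: cons_inj.
by rewrite notin // orbF mem_map //; apply: cons_inj.
Qed.

Lemma cat_vertices t (u v : seq bool) :
  (u ++ v \in vertices t) =
  (u \in vertices t) && (v \in vertices (subtree t u)).
Proof.
elim: u t => [|b u IHu] [|l r]; rewrite ?nil_vertices //.
by rewrite cat_cons !cons_vertices IHu.
Qed.

Lemma rcons_vertices t (v : seq bool) b :
  rcons v b \in vertices t -> exists l r, subtree t v = Node l r.
Proof.
rewrite -cats1 cat_vertices => /andP[_].
by case: (subtree t v) => [|l r] // _; exists l, r.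
Qed.

Lemma subtree_replace t (v : seq bool) s :
  v \in vertices t -> subtree (replace t v s) v = s.
Proof.
elim: v t => [|b v IHv] [|l r] //; rewrite ?subtree_nil //.
by rewrite cons_vertices; case: b => /= /IHv.
Qed.

Lemma replace_replace t v s s' :
  replace (replace t v s) v s' = replace t v s'.
Proof.
by elim: v t => [|[] v IHv] [|l r] //; rewrite ?replace_nil //= IHv.
Qed.

Lemma replace_vertices t (v : seq bool) s :
  (v \in vertices (replace t v s)) = (v \in vertices t).
Proof.
elim: v t => [|b v IHv] [|l r] //; rewrite ?nil_vertices //.
by rewrite cons_vertices -IHv; case: b; rewrite [replace _ _ _]/= cons_vertices.
Qed.

Lemma size_vertices_Node l r :
  size (vertices (Node l r)) = (size (vertices l) + size (vertices r)).+1.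
Proof. by rewrite /= size_cat !size_map. Qed.

(** Additive form, which avoids truncated subtraction and suits [lia]. *)
Lemma size_replace_vertices t (v : seq bool) s : v \in vertices t ->
  (size (vertices (replace t v s)) + size (vertices (subtree t v)) =
   size (vertices t) + size (vertices s))%N.
Proof.
elim: v t => [|b v IHv] [|l r] //; rewrite ?replace_nil ?subtree_nil 1?addnC //.
by rewrite cons_vertices; case: b => /IHv eq_size; rewrite [replace _ _ _]/=
  [subtree _ _]/= !size_vertices_Node; lia.
Qed.

Lemma uniq_vertices t : uniq (vertices t).
Proof.
have cons_inj c : injective (cons c : seq bool -> _) by move=> u w [].
elim: t => //= l IHl r IHr; apply/andP; split.
  by rewrite mem_cat negb_or; apply/andP; split; apply/mapP => -[].
rewrite cat_uniq !map_inj_uniq // IHl IHr andbT /=.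
by apply/hasPn => _ /mapP[u _ ->]; apply/mapP => -[].
Qed.

(** * Leaves, and insertion against leaf removal *)

Lemma mem_leaves t (v : seq bool) :
  (v \in leaves t) = (v \in vertices t) && (subtree t v == Leaf).
Proof. by rewrite mem_filter andbC. Qed.

Lemma leaves_Node l r :
  leaves (Node l r) = map (cons false) (leaves l) ++ map (cons true) (leaves r).
Proof. by rewrite /leaves /= filter_cat !filter_map. Qed.

Lemma size_leaves t : ((size (leaves t)).*2 = (size (vertices t)).+1)%N.
Proof.
elim: t => // l IHl r IHr.
by rewrite leaves_Node /= !size_cat !size_map; lia.
Qed.

Lemma parent_rcons v b : parent (rcons v b) = v.
Proof. by rewrite /parent size_rcons -cats1 take_size_cat. Qed.

Lemma sibling_rcons v b : sibling (rcons v b) = rcons v (~~ b).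
Proof. by rewrite /sibling parent_rcons last_rcons. Qed.

Lemma remy_choicesE t c : (c \in remy_choices t) = (c.1 \in vertices t).
Proof.
apply/allpairsP/idP => [[[v b] /= [vt _ ->]] //|ct].
by exists c; case: c ct => v []; split.
Qed.

Lemma uniq_remy_choices t : uniq (remy_choices t).
Proof.
by apply: allpairs_uniq => //; [exact: uniq_vertices | move=> [? ?] [? ?] _ _].
Qed.

Lemma size_remy_choices t : size (remy_choices t) = (size (vertices t) * 2)%N.
Proof. by rewrite size_allpairs. Qed.

(** The bit [c.2] says where the cut-off subtree goes, so the fresh leaf is the other child of the
    inserted copy of [aleph]; hence the negation. *)
Definition new_leaf (c : seq bool * bool) : seq bool := rcons c.1 (~~ c.2).

Lemma new_leaf_inj : injective new_leaf.
Proof.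
move=> [u b] [v c] /rcons_inj[/= -> /(congr1 negb)].
by rewrite !negbK => ->.
Qed.

Lemma subtree_remy_insert s c : c.1 \in vertices s ->
  subtree (remy_insert s c) c.1 = replace aleph [:: c.2] (subtree s c.1).
Proof. exact: subtree_replace. Qed.

Lemma size_remy_insert s c : c.1 \in vertices s ->
  size (vertices (remy_insert s c)) = (size (vertices s) + 2)%N.
Proof.
move=> /size_replace_vertices eq_size.
have := eq_size (replace aleph [:: c.2] (subtree s c.1)).
rewrite -[replace s c.1 _]/(remy_insert s c).
by case: c.2; rewrite [replace aleph _ _]/= !size_vertices_Node /=; lia.
Qed.

Lemma new_leaf_leaves s c :
  c.1 \in vertices s -> new_leaf c \in leaves (remy_insert s c).
Proof.
move=> cs; rewrite mem_leaves /new_leaf subtree_rcons -cats1 cat_vertices.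
rewrite subtree_remy_insert //.
rewrite [_ \in vertices (remy_insert _ _)]replace_vertices cs.
by case: c.2; rewrite [replace aleph _ _]/= cons_vertices.
Qed.

Lemma remy_insertK s c :
  c.1 \in vertices s -> remove_leaf (remy_insert s c) (new_leaf c) = s.
Proof.
move=> cs; rewrite /remove_leaf parent_rcons sibling_rcons subtree_rcons.
rewrite subtree_remy_insert // negbK replace_replace.
by case: c.2 => /=; rewrite subtree_nil replace_subtree.
Qed.

(** The subtree of [t] at the parent [c.1] is a node with a leaf on the side opposite to [c.2]. It
    is therefore a copy of [aleph] carrying the sibling's subtree on side [c.2], which is what
    insertion rebuilds. *)
Lemma remove_leafK t c : new_leaf c \in leaves t ->
  (c.1 \in vertices (remove_leaf t (new_leaf c))) /\
  remy_insert (remove_leaf t (new_leaf c)) c = t.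
Proof.
case: c => v b; rewrite mem_leaves /new_leaf /= => /andP[wt /eqP leaf_w].
have vt : v \in vertices t by move: wt; rewrite -cats1 cat_vertices => /andP[].
rewrite /remove_leaf /remy_insert /= parent_rcons sibling_rcons negbK.
rewrite replace_vertices subtree_replace // replace_replace; split => //.
rewrite -[RHS](replace_subtree t v); congr replace.
have [l [r tv]] := rcons_vertices _ _ _ wt.
move: leaf_w; rewrite !subtree_rcons tv.
by case: b {wt} => /=; rewrite !subtree_nil => ->.
Qed.

(** [new_leaf] is a bijection between the two sets being counted: [remy_insertK] and [remove_leafK]
    give the two inclusions. If [t] were [Leaf], its root would be a leaf that no insertion
    creates. *)
Lemma count_remy_insert (s t : bintree) : t != Leaf ->
  count (fun c => remy_insert s c == t) (remy_choices s) =
  count (fun w => remove_leaf t w == s) (leaves t).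
Proof.
move=> t_neq; rewrite -!size_filter -(size_map new_leaf).
apply/perm_size/uniq_perm.
- by rewrite (map_inj_uniq new_leaf_inj) filter_uniq // uniq_remy_choices.
- by rewrite !filter_uniq // uniq_vertices.
move=> w; rewrite mem_filter; apply/mapP/andP => [[c]|[/eqP ws wt]].
  rewrite mem_filter remy_choicesE => /andP[/eqP <- cs ->].
  by rewrite remy_insertK // new_leaf_leaves.
have [v [b wE]] : exists v b, w = rcons v b.
  case: (lastP w) wt => [|v b _]; last by exists v, b.
  by rewrite mem_leaves subtree_nil (negPf t_neq) andbF.
have wc : w = new_leaf (v, ~~ b) by rewrite wE /new_leaf negbK.
exists (v, ~~ b) => //; rewrite mem_filter remy_choicesE.
rewrite wc in wt ws; have [] := remove_leafK _ _ wt.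
by rewrite ws => -> ->; rewrite eqxx.
Qed.

(** A removal giving a tree makes the count of insertions back into [t] positive, and any insertion
    adds two vertices. *)
Lemma size_remove_leaf (t : bintree) (w : seq bool) :
  t != Leaf -> w \in leaves t ->
  (size (vertices (remove_leaf t w)) + 2 = size (vertices t))%N.
Proof.
move=> t_neq wt; have: (0 < count (fun u => remove_leaf t u == remove_leaf t w)
    (leaves t))%N by rewrite -has_count; apply/hasP; exists w.
rewrite -count_remy_insert // -has_count => /hasP[c].
by rewrite remy_choicesE => cs /eqP ct; rewrite -[in RHS]ct size_remy_insert.
Qed.

Lemma size_vertices_gt0 t : (0 < size (vertices t))%N.
Proof. by case: t. Qed.

Lemma size_vertices3 t : size (vertices t) = 3 -> t = aleph.
Proof.
case: t => [|[|a b] [|c e]] //; rewrite !size_vertices_Node => eq3; exfalso;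
  move: eq3.
- by have := size_vertices_gt0 c; have := size_vertices_gt0 e; lia.
- by have := size_vertices_gt0 a; have := size_vertices_gt0 b; lia.
- by have := size_vertices_gt0 a; have := size_vertices_gt0 c; lia.
Qed.

(** * Tree-valued random variables and the one-step law of the chain *)

Lemma measurable_preimage (R : realType) (d : measure_display)
    (Omega : measurableType d) (P : probability Omega R)
    (X : {RV P >-> bintree}) (A : set bintree) : measurable (X @^-1` A).
Proof. by rewrite -[_ @^-1` _]setTI; exact: measurable_funPT. Qed.

(** The values of [X] are enumerated by their codes, so that sigma-additivity applies to a series
    over the naturals; a code of no tree contributes the empty set. *)
Lemma measure_countable_split (R : realType) (d : measure_display)
    (Omega : measurableType d) (P : probability Omega R)
    (X : {RV P >-> bintree}) (B : set Omega) : measurable B ->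
  P B = (\sum_(i <oo) P (B `&` X @^-1` [set z | pickle z = i]))%E.
Proof.
move=> mB; rewrite -measure_semi_bigcup.
- rewrite -setI_bigcupr; congr (P _); apply/seteqP; split => [w Bw|w []//].
  by split => //; exists (pickle (X w)).
- by move=> i; apply: measurableI => //; exact: measurable_preimage.
- by apply/trivIsetP => i j _ _ /eqP ij; apply/seteqP; split => // w
    [[_ /= wi] [_ /= wj]]; case: ij; rewrite -wi -wj.
- by apply: bigcup_measurable => i _; apply: measurableI => //;
    exact: measurable_preimage.
Qed.

Lemma preimage_pickle (T : Type) (X : T -> bintree) i :
  (exists z, pickle z = i /\
     X @^-1` [set z | pickle z = i] = X @^-1` [set z]) \/
  (forall z : bintree, pickle z <> i) /\ X @^-1` [set z | pickle z = i] = set0.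
Proof.
have [[z zi]|no_z] := pselect (exists z : bintree, pickle z = i).
  left; exists z; split=> //; apply/seteqP; split => w /=; last by move=> ->.
  by rewrite -zi => /(pcan_inj pickleK).
right; split => [z zi|]; first by apply: no_z; exists z.
by apply/seteqP; split => // w /= wi; apply: no_z; exists (X w).
Qed.

(** The factor [k] is the same on every slice, so it comes out of the series. This is what allows
    one coordinate of the past to be forgotten. *)
Lemma measure_cond_split (R : realType) (d : measure_display)
    (Omega : measurableType d) (P : probability Omega R)
    (X : {RV P >-> bintree}) (B C : set Omega) (k : R) :
  measurable B -> measurable C ->
  (forall z, P ((B `&` X @^-1` [set z]) `&` C) =
             (k%:E * P (B `&` X @^-1` [set z]))%E) ->
  P (B `&` C) = (k%:E * P B)%E.
Proof.
move=> mB mC split_z.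
rewrite (measure_countable_split _ _ _ _ X _ mB) -nneseriesZl //.
rewrite (measure_countable_split _ _ _ _ X) //; last exact: measurableI.
apply: eq_eseriesr => i _; rewrite setIAC.
have [[z [_ ->]]|[_ ->]] := preimage_pickle _ X i; first exact: split_z.
by rewrite setI0 set0I !measure0 mule0.
Qed.

(** The product form also covers null events [B], where both sides vanish, so zero-probability
    histories cause no case distinction later. *)
Lemma cond_prob_mul (R : realType) (d : measure_display)
    (Omega : measurableType d) (P : probability Omega R) (A B : set Omega)
    (k : R) :
  measurable A -> measurable B -> (P B != 0%E -> cond_prob P A B = k) ->
  P (B `&` A) = (k%:E * P B)%E.
Proof.
move=> mA mB cond_k; have [PB0|PB0] := eqVneq (P B) 0%E.
  rewrite PB0 mule0; apply/eqP; rewrite eq_le measure_ge0 andbT -PB0.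
  by apply: le_measure; rewrite ?inE //; exact: measurableI.
have PfB : P B \is a fin_num by exact: fin_num_measure.
have PfBA : P (B `&` A) \is a fin_num.
  by apply: fin_num_measure; exact: measurableI.
rewrite -(fineK PfB) -(fineK PfBA) -EFinM -(cond_k PB0) /cond_prob setIC.
by rewrite divfK // fine_eq0.
Qed.

(** Induction on [m]: the window starting after time 0 is the full history of the Markov hypothesis,
    and each step drops the oldest remaining time by summing over its value. *)
Lemma remy_chain_window (R : realType) (d : measure_display)
    (Omega : measurableType d) (P : probability Omega R)
    (T : nat -> {RV P >-> bintree}) (n m : nat) (x : nat -> bintree)
    (y : bintree) :
  remy_chain T -> (m < n)%N ->
  let window := \bigcap_(k in [set k | (m < k <= n)%N]) T k @^-1` [set x k] in
  P (window `&` T n.+1 @^-1` [set y]) =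
  ((remy_kernel R (x n) [set y])%:E * P window)%E.
Proof.
move=> chainT; elim: m x => [|m IHm] x mn window.
  apply: cond_prob_mul.
  - exact: measurable_preimage.
  - by apply: bigcap_measurable => [|k _]; [exists n; rewrite /= mn leqnn|
      exact: measurable_preimage].
  - exact: remy_chain_step.
apply: (measure_cond_split _ _ _ _ (T m.+1)).
- by apply: bigcap_measurable => [|k _]; [exists n; rewrite /= mn leqnn|
    exact: measurable_preimage].
- exact: measurable_preimage.
move=> z; pose x' k := if k == m.+1 then z else x k.
have -> : window `&` T m.+1 @^-1` [set z] =
    \bigcap_(k in [set k | (m < k <= n)%N]) T k @^-1` [set x' k].
  apply/seteqP; split => [w [ww /= wz] k /= /andP[mk kn]|w ww].
    rewrite /x'; case: eqP => [->//|/eqP km].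
    by apply: ww; rewrite /= kn andbT ltn_neqAle eq_sym km.
  split.
    move=> k /= /andP[mk kn]; have := ww k; rewrite /= /x' (gtn_eqF mk).
    by apply; rewrite kn (ltnW mk).
  by have := ww m.+1; rewrite /= /x' eqxx; apply; rewrite ltnSn (ltnW mn).
(* As [m.+1 < n], the altered path still has value [x n] at time [n], so the factor does not depend
   on [z]. *)
by rewrite IHm ?(ltnW mn) // /x' (gtn_eqF mn).
Qed.

Lemma remy_chain_joint (R : realType) (d : measure_display)
    (Omega : measurableType d) (P : probability Omega R)
    (T : nat -> {RV P >-> bintree}) (n : nat) (s t : bintree) :
  remy_chain T -> (0 < n)%N ->
  P (T n @^-1` [set s] `&` T n.+1 @^-1` [set t]) =
  ((remy_kernel R s [set t])%:E * P (T n @^-1` [set s]))%E.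
Proof.
case: n => // n chainT _.
have := remy_chain_window _ _ _ _ _ n.+1 n (fun=> s) t chainT (ltnSn n).
(* The shortest window contains the present time alone. *)
rewrite (_ : [set k | (n < k <= n.+1)%N] = [set n.+1]) ?bigcap_set1 //.
by apply/seteqP; split => k /=; lia.
Qed.

(** * Joint law of consecutive trees, and uniformity *)

Lemma sum_indic1 (R : realType) (I : Type) (s : seq I) (f : I -> bintree) y :
  \sum_(i <- s) \1_[set y] (f i) = (count (fun i => f i == y) s)%:R :> R.
Proof.
elim: s => [|i s IHs]; first by rewrite big_nil.
rewrite big_cons IHs /= natrD indicE; congr (_%:R + _).
by congr nat_of_bool; apply/idP/eqP; rewrite inE.
Qed.

Lemma remy_kernelE (R : realType) (s t : bintree) : t != Leaf ->
  remy_kernel R s [set t] =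
  (count (fun w => remove_leaf t w == s) (leaves t))%:R /
  (size (vertices s) * 2)%:R.
Proof.
by move=> t_neq; rewrite /remy_kernel /uniform_law sum_indic1
  count_remy_insert // size_remy_choices.
Qed.

Lemma nneseries_pick (R : realType) (j : nat) (a : \bar R) : (0 <= a)%E ->
  (\sum_(i <oo) (if j == i then a else 0))%E = a.
Proof.
move=> a0; rewrite (@nneseriesD1 _ _ j) //; last by move=> k _; case: ifP.
rewrite eqxx eseries0 ?adde0 // => i _ /= /negPf.
by rewrite eq_sym => ->.
Qed.

(** Each leaf of [t] contributes the mass [p] of the tree left by its removal, divided by the
    [4 * n + 2] choices available in a tree with [2 * n + 1] vertices. The set [A] is arbitrary
    because [setT] yields the marginal law of [T n.+1]. *)
Lemma remy_joint_law (R : realType) (d : measure_display)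
    (Omega : measurableType d) (P : probability Omega R)
    (T : nat -> {RV P >-> bintree}) (n : nat) (p : R) (t : bintree)
    (A : set bintree) :
  remy_chain T -> (0 < n)%N -> 0 <= p ->
  (forall s, size (vertices s) = (2 * n + 1)%N ->
     P (T n @^-1` [set s]) = p%:E) ->
  size (vertices t) = (2 * n + 3)%N ->
  P (T n @^-1` A `&` T n.+1 @^-1` [set t]) =
  (p / (4 * n + 2)%:R * \sum_(w <- leaves t) \1_A (remove_leaf t w))%:E.
Proof.
move=> chainT n_gt0 p_ge0 unifT size_t.
have t_neq : t != Leaf by apply/eqP => t0; move: size_t; rewrite t0 /=; lia.
set c := p / _; have c_ge0 : 0 <= c by rewrite divr_ge0.
have mT m B : measurable (T m @^-1` B) by exact: measurable_preimage.
rewrite (measure_countable_split _ _ _ _ (T n)); last exact: measurableI.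
pose term w := (c * \1_A (remove_leaf t w))%:E.
have term_ge0 w : (0 <= term w)%E by rewrite lee_fin mulr_ge0.
(* The term of code [i] is spread over the leaves whose removal gives the tree coded by [i]. After
   exchanging the sums, the series of each leaf has a single term. *)
rewrite (eq_eseriesr (g := fun i => (\sum_(w <- leaves t)
    (if pickle (remove_leaf t w) == i then term w else 0))%E)); last first.
  move=> i _; have [[z [zi ->]]|[no_z ->]] := preimage_pickle _ (T n) i;
    last first.
    rewrite setI0 measure0 big1 // => w _.
    by case: eqP => // /no_z.
  rewrite (eq_bigr (fun w => if remove_leaf t w == z then term w else 0%E));
    last by move=> w _; rewrite -zi (inj_eq (pcan_inj pickleK)).
  have [Az|nAz] := pselect (A z); last first.
    rewrite (_ : _ `&` T n @^-1` [set z] = set0); last first.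
      by apply/seteqP; split => // w [[Aw _] wz]; apply: nAz; rewrite -wz.
    rewrite measure0 big1 // => w _; case: eqP => // wz.
    by rewrite /term wz indicE memNset // mulr0.
  rewrite (_ : _ `&` T n @^-1` [set z] =
    T n @^-1` [set z] `&` T n.+1 @^-1` [set t]); last first.
    apply/seteqP; split => w [] /=.
      by move=> [_ wt] wz.
    by move=> wz wt; do 2?split => //; rewrite wz.
  rewrite remy_chain_joint // remy_kernelE //.
  rewrite (_ : (\sum_(w <- _) _)%E =
    (c * (count (fun w => remove_leaf t w == z) (leaves t))%:R)%:E); last first.
    rewrite -sum_indic1 mulr_sumr -sumEFin; apply: eq_bigr => w _.
    rewrite /term !indicE; case: eqP => [->|/eqP wz].
      by rewrite !mem_set.
    by rewrite memNset ?mulr0 //= => /eqP; rewrite (negPf wz).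
  (* If no removal gives [z], the kernel vanishes; otherwise [z] has [2 * n + 1] vertices, which is
     what [unifT] requires. *)
  have [/hasP[w wt /eqP wz]|/negbTE] :=
    boolP (has (fun w => remove_leaf t w == z) (leaves t)); last first.
    by rewrite has_count lt0n => /negbFE/eqP ->; rewrite mul0r mulr0 mul0e.
  have := size_remove_leaf _ _ t_neq wt; rewrite size_t wz => size_z.
  rewrite unifT; last by lia.
  rewrite -EFinM (_ : (size _ * 2)%N = (4 * n + 2)%N); last by lia.
  by congr EFin; rewrite /c; ring.
rewrite nneseries_sum; last by move=> w i _; case: ifP.
under eq_bigr do rewrite nneseries_pick //.
by rewrite /term sumEFin mulr_sumr.
Qed.

Lemma sum_indicT (R : realType) (I : Type) (s : seq I) (f : I -> bintree) :
  \sum_(i <- s) \1_setT (f i) = (size s)%:R :> R.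
Proof.
rewrite indicT; under eq_bigr do rewrite /cst.
by rewrite big_const_seq count_predT iter_addr_0.
Qed.

(** With [A] the full set, the joint law depends on [t] only through its number of leaves, which its
    size determines. *)
Lemma remy_chain_uniform (R : realType) (d : measure_display)
    (Omega : measurableType d) (P : probability Omega R)
    (T : nat -> {RV P >-> bintree}) (n : nat) :
  remy_chain T -> (0 < n)%N ->
  exists2 p : R, 0 < p & forall s, size (vertices s) = (2 * n + 1)%N ->
    P (T n @^-1` [set s]) = p%:E.
Proof.
move=> chainT; elim: n => // -[_ _|n IHn _].
  exists 1 => // s /size_vertices3 ->; exact: remy_chain_start.
have [//|p p_gt0 unifT] := IHn.
(* There are [4 * n.+1 + 2] choices at time [n.+1], and a tree attained at time [n.+2] has [n.+3]
   leaves. *)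
exists (p / (4 * n.+1 + 2)%:R * n.+3%:R) => [|t size_t].
  by rewrite mulr_gt0 // divr_gt0 // ltr0n; lia.
have size_t' : size (vertices t) = (2 * n.+1 + 3)%N by lia.
rewrite -[X in P X]setTI -(preimage_setT (T n.+1)).
rewrite (remy_joint_law _ _ _ _ _ _ _ _ setT chainT _ (ltW p_gt0) unifT) //.
rewrite sum_indicT; congr (_ * _%:R)%:E.
by have := size_leaves t; lia.
Qed.

Theorem mainTheorem4 (R : realType) (d : measure_display)
    (Omega : measurableType d) (P : probability Omega R)
    (T : nat -> {RV P >-> bintree}) (n : nat) (t : bintree) :
  remy_chain T ->
  (0 < n)%N ->
  size (vertices t) = (2 * n + 3)%N ->
  forall A : set bintree,
    cond_prob P (T n @^-1` A) (T n.+1 @^-1` [set t]) = leaf_removal_law R t A.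
Proof.
move=> chainT n_gt0 size_t A.
have [p p_gt0 unifT] := remy_chain_uniform _ _ _ _ _ _ chainT n_gt0.
have joint B := remy_joint_law _ _ _ _ _ _ _ _ B chainT n_gt0 (ltW p_gt0)
  unifT size_t.
(* The conditioning event is the joint event with [A] replaced by [setT], so numerator and
   denominator share the factor [p / (4 * n + 2)%:R], which cancels because [p] is positive. *)
rewrite /cond_prob joint -[X in P X]setTI -(preimage_setT (T n)) joint /=.
rewrite sum_indicT -mulf_div divff ?mul1r //.
by rewrite mulf_neq0 ?gt_eqF // invr_gt0 ltr0n; lia.
Qed.
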